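(* Let $n$ and $t$ be integers with $1\leq t\leq \frac{n-1}{2}$, let $k$ be a positive integer, and let $G=G(n;\{1,2,\ldots,t\})$ be the circulant graph on vertex set $\mathbb{Z}_n$ in which distinct vertices $i,j$ are adjacent if and only if $\min\{|i-j|,\,n-|i-j|\}\in\{1,2,\ldots,t\}$ (equivalently, $G=C_n^t$, the $t$-th power of the cycle $C_n$). Then the integer $\{k\}$-domination number of $G$ satisfies $$\gamma_k(G)=\left\lceil \frac{kn}{2t+1}\right\rceil.$$
   Context: For a simple graph $G$, a function $f:V(G)\to\mathbb{N}\cup\{0\}$ is an integer $\{k\}$-domination function if $\sum_{u\in N_G[v]}f(u)\geq k$ for every $v\in V(G)$, where $N_G[v]$ is the closed neighborhood of $v$. The integer $\{k\}$-domination number $\gamma_k(G)$ is the minimum of $\sum_{v\in V(G)}f(v)$ over all integer $\{k\}$-domination functions $f$ of $G$. *)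

(* Defs.v *)
From mathcomp Require Import all_boot all_order all_algebra.
From mathcomp Require Import boolp.

Set Implicit Arguments.
Unset Strict Implicit.
Unset Printing Implicit Defensive.

Record sgraph := SGraph {
  vertex :> finType;
  adj : rel vertex;
  adj_sym : symmetric adj;
  adj_irrefl : irreflexive adj }.

Definition closed_nbhd (G : sgraph) (v : G) : {set G} :=
  [set u | (u == v) || adj v u].

Definition dom_function (G : sgraph) (k : nat) (f : G -> nat) : Prop :=
  forall v : G, k <= \sum_(u in closed_nbhd v) f u.

Definition weight (G : sgraph) (f : G -> nat) : nat := \sum_(v : G) f v.

Definition dom_weight (G : sgraph) (k : nat) : pred nat :=
  fun m => `[< exists f : G -> nat, dom_function k f /\ weight f = m >].

Lemma dom_weight_ex (G : sgraph) (k : nat) : exists m, dom_weight G k m.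
Proof.
exists (weight (fun _ : G => k)); apply/asboolP.
exists (fun=> k); split=> // v.
by rewrite (bigD1 v) /= ?inE ?eqxx // leq_addr.
Qed.

Definition dom_number (k : nat) (G : sgraph) : nat :=
  ex_minn (dom_weight_ex G k).

Definition cyc_dist (n : nat) (i j : 'I_n) : nat :=
  let d := absz ((i : nat)%:Z - (j : nat)%:Z)%R in minn d (n - d).

Definition circ_adj (n : nat) (S : pred nat) : rel 'I_n :=
  fun i j => (i != j) && S (cyc_dist i j).

Lemma circ_adj_sym (n : nat) (S : pred nat) : symmetric (@circ_adj n S).
Proof. by move=> i j; rewrite /circ_adj /cyc_dist eq_sym distnC. Qed.

Lemma circ_adj_irrefl (n : nat) (S : pred nat) : irreflexive (@circ_adj n S).
Proof. by move=> i; rewrite /circ_adj eqxx. Qed.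

(* The circulant graph G(n; S), with Z_n represented by the residues 0..n-1. *)
Definition circulant (n : nat) (S : pred nat) : sgraph :=
  SGraph (@circ_adj_sym n S) (@circ_adj_irrefl n S).

(* Main.v *)
Require Import Defs.
From mathcomp Require Import all_boot all_order all_algebra.
From mathcomp Require Import boolp zify.

(** Write [m = 2 t + 1]. Every closed neighbourhood of [C_n^t] is a cyclic
    window of [m] consecutive residues. Double counting pairs
    (vertex, neighbour) gives [k n <= m w] for the weight [w] of any
    {k}-dominating function. Conversely, if [k n <= m w], spread the weight [w]
    evenly: with [F x = floor (x w / n)], the increments [F (x + 1) - F x] are
    [n]-periodic, so the sum over the window starting at [a] telescopes to
    [F (a + m) - F a >= floor (m w / n) >= k], also when the window wraps
    around. *)

Set Implicit Arguments.
Unset Strict Implicit.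
Unset Printing Implicit Defensive.

Import Order.TTheory GRing.Theory Num.Theory.

Lemma closed_nbhdC (G : sgraph) (u v : G) :
  (u \in closed_nbhd v) = (v \in closed_nbhd u).
Proof. by rewrite !inE eq_sym adj_sym. Qed.

Lemma dom_function_weight_regular (G : sgraph) (m k : nat) (f : G -> nat) :
    (forall v : G, #|closed_nbhd v| = m) -> dom_function k f ->
  k * #|G| <= m * weight f.
Proof.
move=> card_nbhd dom_f.
have -> : m * weight f = \sum_(v : G) \sum_(u in closed_nbhd v) f u.
  rewrite (exchange_big_dep predT) //= /weight big_distrr /=.
  apply: eq_bigr => u _; rewrite -[in LHS](card_nbhd u) -sum_nat_const.
  by apply: eq_bigl => v; rewrite closed_nbhdC.
by rewrite mulnC -sum_nat_const; apply: leq_sum => v _; apply: dom_f.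
Qed.

Lemma dom_number_le (k : nat) (G : sgraph) (w : nat) :
    (exists2 f : G -> nat, dom_function k f & weight f = w) ->
  dom_number k G <= w.
Proof.
rewrite /dom_number; case: ex_minnP => d _ min_d [f dom_f wf].
by apply: min_d; apply/asboolP; exists f.
Qed.

Lemma dom_numberP (k : nat) (G : sgraph) :
  exists2 f : G -> nat, dom_function k f & weight f = dom_number k G.
Proof.
rewrite /dom_number; case: ex_minnP => d /asboolP[f [dom_f wf]] _.
by exists f.
Qed.

Section CyclePower.

Variables p t : nat.
Let n := p.+1.
Let m := 2 * t + 1.
Hypothesis le_mn : m <= n.

Let G := circulant n (fun d => 1 <= d <= t).

(** The start [a] is a natural number rather than a residue, so that sums over a window can
    telescope in [nat]. The reduction modulo [n] keeps [inord] away from its default value. *)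
Definition window (a : nat) (j : 'I_m) : 'I_n := inord ((a + j) %% n).

Lemma val_window a j : window a j = (a + j) %% n :> nat.
Proof. by rewrite inordK // ltn_mod. Qed.

Lemma window_inj a : injective (window a).
Proof.
move=> i j /(congr1 val); rewrite /= !val_window => /eqP.
rewrite eqn_modDl !modn_small ?(leq_trans (ltn_ord _)) // => /eqP.
exact: val_inj.
Qed.

(** Adding [n] to the start [v - t] avoids truncated subtraction and does not change the
    residues. *)
Lemma closed_nbhd_window (v : G) :
  closed_nbhd v = [set window (v + n - t) j | j : 'I_m].
Proof.
have lt_vn : (v : 'I_n) < n by apply: ltn_ord.
apply/setP => u; have lt_un : (u : 'I_n) < n by apply: ltn_ord.
have -> : (u \in closed_nbhd v) =
    (minn (maxn u v - minn u v) (n - (maxn u v - minn u v)) <= t).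
  rewrite inE /= /circ_adj /cyc_dist -!val_eqE /=.
  move: lt_vn lt_un; move: (u : nat) (v : nat) => x y; lia.
apply/idP/imsetP => [le_ut | [j _ ->]].
(* Here [q] records the wrapping: [q = 1] if [u] is within [t] of [v] without wrapping, [q = 2] if
   it is reached past [n - 1], and [q = 0] if it is reached below [0]. *)
- have [j [lt_jm [q def_j]]] :
      exists j, j < m /\ exists q, v + n - t + j = q * n + u.
    case: (leqP (maxn u v - minn u v) t) => [le_dt|lt_td].
      by exists (u + t - v); split; [lia | exists 1; lia].
    case: (leqP u v) => [le_uv|lt_vu].
      by exists (u + n + t - v); split; [lia | exists 2; lia].
    by exists (u + t - v - n); split; [lia | exists 0; lia].
  exists (Ordinal lt_jm) => //; apply: val_inj.
  by rewrite /= val_window /= def_j modnMDl modn_small.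
- have lt_jm := ltn_ord j; rewrite val_window.
  set x := _ + _; have := divn_eq x n; have := ltn_pmod x (ltn0Sn p).
  rewrite -/n; move: (x %/ n) (x %% n) => q r lt_rn def_x.
  (* Since [j <= 2 * t], the dividend is at most [v + n + t < 3 * n]. *)
  have lt_q3 : q < 3 by rewrite -(ltn_pmul2r (ltn0Sn p)) -/n; lia.
  by case: q lt_q3 def_x => [|[|[|//]]] _ def_x; lia.
Qed.

Lemma card_closed_nbhd_cycle_power (v : G) : #|closed_nbhd v| = m.
Proof. by rewrite closed_nbhd_window card_imset ?card_ord //; apply: window_inj. Qed.

Lemma cycle_power_dom_function k w :
    k * n <= m * w ->
  exists2 f : G -> nat, dom_function k f & weight f = w.
Proof.
move=> le_kw; pose F x := (x * w) %/ n.
have leF x y : x <= y -> F x <= F y by move=> ?; rewrite leq_div2r ?leq_mul2r; lia.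
have FD q x : F (q * n + x) = q * w + F x.
  by rewrite /F mulnDl mulnAC divnMDl.
pose f (i : nat) := F i.+1 - F i.
have f_mod x : f (x %% n) = f x.
  by rewrite [in RHS](divn_eq x n) /f -addnS !FD subnDl.
have sum_f a b : \sum_(j < b) f (a + j) = F (a + b) - F a.
  elim: b => [|b IHb]; first by rewrite big_ord0 addn0 subnn.
  rewrite big_ord_recr /= IHb /f addnS.
  by have := leF a (a + b); have := leF (a + b) (a + b).+1; lia.
exists (fun i : 'I_n => f i) => [v|].
- rewrite closed_nbhd_window big_imset /=; last by move=> i j _ _ /window_inj.
  under eq_bigr => j _ do rewrite val_window f_mod.
  rewrite sum_f leq_subRL ?leF ?leq_addr //.
  (* Floors are superadditive, and [F m >= k] is the hypothesis [le_kw]. *)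
  apply: leq_trans (_ : F (v + n - t) + F m <= _).
    by rewrite leq_add2l /F leq_divRL.
  by rewrite /F [X in _ <= X %/ _]mulnDl divnD // leq_addr.
- rewrite /weight; under eq_bigr => i _ do rewrite -[i : nat]add0n.
  by rewrite sum_f /F add0n mul0n div0n subn0 mulKn.
Qed.

(** Stated for every [w], this is the property that characterizes the ceiling of [k * n / m] among
    natural numbers. *)
Lemma dom_number_cycle_power_le k w :
  (dom_number k G <= w) = (k * n <= m * w).
Proof.
apply/idP/idP => [le_dw | le_kw]; last first.
  exact/dom_number_le/cycle_power_dom_function.
have [f dom_f wf] := dom_numberP k G.
have := dom_function_weight_regular card_closed_nbhd_cycle_power dom_f.
by rewrite card_ord wf => /leq_trans-> //; rewrite leq_mul2l le_dw orbT.
Qed.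

End CyclePower.

Local Open Scope ring_scope.

Theorem theorem2p8 (n t k : nat) (t_ge1 : (1 <= t)%N)
  (t_le : t%:R <= (n%:R - 1) / 2 :> rat) (k_gt0 : (0 < k)%N) :
  (dom_number k (circulant n (fun d => (1 <= d <= t)%N)))%:Z =
    Num.ceil ((k * n)%:R / (2 * t + 1)%:R : rat).
Proof.
have {t_le} le_tn : (2 * t + 1 <= n)%N.
  by move: t_le; rewrite ler_pdivlMr // lerBrDr -natrM natr1 ler_nat; lia.
case: n le_tn => [|p] le_tn; first by rewrite addn1 in le_tn.
set d := dom_number _ _.
have ceil_le (w : nat) : (Num.ceil ((k * p.+1)%:R / (2 * t + 1)%:R : rat) <= w%:Z)
    = (d <= w)%N.
  rewrite /d dom_number_cycle_power_le // ceil_le_int.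
  rewrite ler_pdivrMr ?ltr0n ?addn1 //.
  by rewrite -[w%:~R]/(w%:R) -natrM ler_nat [(w * _)%N]mulnC.
(* Nonnegativity makes the ceiling a natural number [c]. Then [ceil_le] at [w = d] and at [w = c]
   gives the two inequalities. *)
have : 0 <= Num.ceil ((k * p.+1)%:R / (2 * t + 1)%:R : rat).
  by rewrite ceil_ge0 (lt_le_trans (ltrN10 _)) // divr_ge0.
case: (Num.ceil _) ceil_le => // c ceil_le _.
by apply/eqP; rewrite eqz_nat eqn_leq -ceil_le lexx -lez_nat ceil_le leqnn.
Qed.
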